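(* Let $m,N,d_1,d_2\ge 1$ be integers, let $\theta:[m]\to[m]$ be a bijection, and let $\sigma$ (a permutation of $[2m]$) and $\tau$ (a partial permutation of $[2m]$) be the associated maps defined in the context. If $\theta$ is non-crossing, then $$\max_{\|A_1\|,\ldots,\|A_{2m}\|\le 1}\left\|\left(\mathrm{Tr}_\sigma^{\otimes d_1}\otimes\mathrm{Tr}_\tau^{\otimes d_2}\right)(A_1,\ldots,A_{2m})\right\| = N^{d_1(1+m)},$$ where the maximum is over $A_1,\ldots,A_{2m}\in M_N(\mathbb{C})^{\otimes(d_1+d_2)}$ with operator norm at most $1$.
   Context: $[n]=\{1,\ldots,n\}$. Given the bijection $\theta:[m]\to[m]$, define permutations $\sigma',\sigma''$ of $[m]$ by $\sigma'(i)=\theta(i)+1 \pmod m$ (values taken in $[m]$) and $\sigma''(\theta(i))=i$. Define the permutation $\sigma$ of $[2m]$ by $\sigma(2i-1)=2\sigma'(i)-1$ and $\sigma(2i)=2\sigma''(i)$ for $i\in[m]$. Let $\tau$ be the partial permutation of $[2m]$ with domain $D(\tau)=[2m-1]$ and $\tau(i)=i+1$. Let $\tilde\theta$ be the pairing of $[2m]$ with pairs $\{2i-1,2\theta(i)\}$, $i\in[m]$. $\theta$ is called non-crossing if $\tilde\theta$ is a non-crossing pairing, i.e. there are no two pairs $\{a,b\},\{c,d\}$ of $\tilde\theta$ with $a<c<b<d$; otherwise $\theta$ is crossing. Partial trace: a partial permutation $\rho$ of $[n]$ is an injective map $\rho:D(\rho)\to[n]$ with $D(\rho)\subseteq[n]$,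 image $\mathrm{Im}(\rho)$. For partial permutations $\rho_1,\ldots,\rho_k$ of $[n]$ and $A_1,\ldots,A_n\in M_N(\mathbb{C})^{\otimes k}$ (rows and columns indexed by $[N]^k$), $Y=(\mathrm{Tr}_{\rho_1}\otimes\cdots\otimes\mathrm{Tr}_{\rho_k})(A_1,\ldots,A_n)$ is the matrix with rows indexed by $a\in[N]^{\{(i,j):\,i\notin\mathrm{Im}(\rho_j)\}}$, columns indexed by $b\in[N]^{\{(i,j):\,i\notin D(\rho_j)\}}$, and $$Y_{a,b}=\sum\prod_{i=1}^n(A_i)_{(r_{i,1},\ldots,r_{i,k}),(c_{i,1},\ldots,c_{i,k})},$$ summed over all $r,c\in[N]^{[n]\times[k]}$ with $r_{\rho_j(i),j}=c_{i,j}$ for $i\in D(\rho_j)$, $r_{i,j}=a_{i,j}$ for $i\notin\mathrm{Im}(\rho_j)$, and $c_{i,j}=b_{i,j}$ for $i\notin D(\rho_j)$. $\mathrm{Tr}_\sigma^{\otimes d_1}\otimes\mathrm{Tr}_\tau^{\otimes d_2}$ is the case $n=2m$, $k=d_1+d_2$, $\rho_1=\cdots=\rho_{d_1}=\sigma$, $\rho_{d_1+1}=\cdots=\rho_{d_1+d_2}=\tau$; its values are matrices of size $N^{d_2}$. $\|\cdot\|$ is the operator norm. *)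

(* Defs.v *)
From HB Require Import structures.
From mathcomp Require Import all_boot all_order all_algebra all_fingroup.
From mathcomp Require Import complex.
From mathcomp Require Import all_classical all_reals.

Set Implicit Arguments.
Unset Strict Implicit.
Unset Printing Implicit Defensive.

Import Order.TTheory GRing.Theory Num.Theory.

Local Open Scope classical_set_scope.
Local Open Scope ring_scope.
Local Open Scope complex_scope.

(* The index set [n] = {1, ..., n} is 'I_n = {0, ..., n-1}: the element i of  *)
(* [n] is the ordinal with value i - 1.                                       *)

Section OperatorNorm.
Variable R : realType.

Definition l2norm (n : nat) (x : 'cV[R[i]]_n) : R :=
  Num.sqrt (\sum_i Normc.normc (x i 0) ^+ 2).

Definition opnorm (p q : nat) (A : 'M[R[i]]_(p, q)) : R :=
  sup [set l2norm (A *m x) | x in [set x : 'cV[R[i]]_q | l2norm x <= 1]].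

End OperatorNorm.

Record pperm (n : nat) := PPerm {
  pperm_fun :> 'I_n -> option 'I_n;
  pperm_inj : forall i i' : 'I_n,
    pperm_fun i -> pperm_fun i = pperm_fun i' -> i = i'
}.

Definition pdom (n : nat) (rho : pperm n) : {set 'I_n} := [set i | rho i]%SET.

Definition pim (n : nat) (rho : pperm n) : {set 'I_n} :=
  [set i | [exists i', rho i' == Some i]]%SET.

Section PartialTrace.
Variables (R : realType) (N n k : nat).

(* The index set [N]^T; the matrices below are indexed by it through its      *)
(* canonical enumeration enum_rank / enum_val.                                *)
Definition midx (T : finType) := {ffun T -> 'I_N}.

Definition tensmx := 'M[R[i]]_#|midx 'I_k|.

Variable rho : 'I_k -> pperm n.

Definition tr_row := {p : 'I_n * 'I_k | p.1 \notin pim (rho p.2)}.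
Definition tr_col := {p : 'I_n * 'I_k | p.1 \notin pdom (rho p.2)}.

Definition tr_compat (a : midx tr_row) (b : midx tr_col)
    (r c : midx ('I_n * 'I_k)%type) : bool :=
  [&& [forall i : 'I_n, forall i' : 'I_n, forall j : 'I_k,
         (rho j i == Some i') ==> (r (i', j) == c (i, j))],
      [forall p : tr_row, r (val p) == a p]
    & [forall p : tr_col, c (val p) == b p]].

Definition ptrace (A : 'I_n -> tensmx)
    : 'M[R[i]]_(#|midx tr_row|, #|midx tr_col|) :=
  \matrix_(a, b)
    \sum_(rc : midx ('I_n * 'I_k)%type * midx ('I_n * 'I_k)%type
          | tr_compat (enum_val a) (enum_val b) rc.1 rc.2)
      \prod_(i < n)
        A i (enum_rank [ffun j => rc.1 (i, j)])
            (enum_rank [ffun j => rc.2 (i, j)]).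

End PartialTrace.

Lemma perm_pperm_inj (n : nat) (s : {perm 'I_n}) (i i' : 'I_n) :
  Some (s i) -> Some (s i) = Some (s i') -> i = i'.
Proof. by move=> _ [] /perm_inj. Qed.

Definition perm_pperm (n : nat) (s : {perm 'I_n}) : pperm n :=
  PPerm (@perm_pperm_inj n s).

Lemma tau_inj (n : nat) (i i' : 'I_n) :
  (insub i.+1 : option 'I_n) ->
  (insub i.+1 : option 'I_n) = insub i'.+1 -> i = i'.
Proof.
case: insubP => // u _ eu _; case: insubP => // u' _ eu' [uu'].
by apply/val_inj/succn_inj; rewrite -eu -eu' uu'.
Qed.

(* insub i.+1 is undefined exactly at the last element of 'I_n.               *)
Definition tau (n : nat) : pperm n := PPerm (@tau_inj n).

Section Sigma.
Variable m : nat.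

Lemma odd_pos_proof (i : 'I_m) : (2 * i < 2 * m)%N.
Proof. by rewrite ltn_mul2l /=. Qed.

Lemma even_pos_proof (i : 'I_m) : ((2 * i).+1 < 2 * m)%N.
Proof. by rewrite !mul2n ltn_Sdouble. Qed.

Lemma half_pos_proof (p : 'I_(2 * m)) : (p./2 < m)%N.
Proof. by rewrite ltn_half_double -mul2n. Qed.

(* With the shift by one, odd_pos i and even_pos i are the elements 2i - 1    *)
(* and 2i of [2m], so odd_pos has even values and even_pos has odd ones.      *)
Definition odd_pos (i : 'I_m) : 'I_(2 * m) := Ordinal (odd_pos_proof i).
Definition even_pos (i : 'I_m) : 'I_(2 * m) := Ordinal (even_pos_proof i).
Definition half_pos (p : 'I_(2 * m)) : 'I_m := Ordinal (half_pos_proof p).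

Lemma odd_posK : cancel odd_pos half_pos.
Proof. by move=> i; apply: val_inj; rewrite /= (mul2n i) doubleK. Qed.

Lemma even_posK : cancel even_pos half_pos.
Proof. by move=> i; apply: val_inj; rewrite /= (mul2n i) uphalf_double. Qed.

Lemma half_posK (p : 'I_(2 * m)) :
  p = if odd p then even_pos (half_pos p) else odd_pos (half_pos p).
Proof.
apply: val_inj; apply: etrans (esym (odd_double_half p)) _.
by case: (odd p); rewrite /= (mul2n p./2).
Qed.

Variable theta : {perm 'I_m}.

Definition sigma1 : {perm 'I_m} :=
  perm (inj_comp (can_inj (@ordSK m)) (@perm_inj _ theta)).

Definition sigma2 : {perm 'I_m} := theta^-1%g.

Definition sigma_fun (p : 'I_(2 * m)) : 'I_(2 * m) :=
  if odd p then even_pos (sigma2 (half_pos p))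
  else odd_pos (sigma1 (half_pos p)).

Lemma sigma_fun_inj : injective sigma_fun.
Proof.
have od i : odd (odd_pos i) = false by rewrite /= (mul2n i) odd_double.
have ev i : odd (even_pos i) by rewrite /= (mul2n i) odd_double.
move=> p q; rewrite /sigma_fun (half_posK p) (half_posK q).
case: (odd p); case: (odd q); rewrite !(od, ev) !(odd_posK, even_posK) => e.
- by move/(can_inj even_posK)/perm_inj: e => ->.
- by have := ev (sigma2 (half_pos p)); rewrite e od.
- by have := ev (sigma2 (half_pos q)); rewrite -e od.
- by move/(can_inj odd_posK)/perm_inj: e => ->.
Qed.

Definition sigma : {perm 'I_(2 * m)} := perm sigma_fun_inj.

Lemma sigma1E i : sigma1 i = ordS (theta i).
Proof. by rewrite permE. Qed.

Lemma sigma2E i : sigma2 (theta i) = i.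
Proof. exact: permK. Qed.

Lemma sigma_odd i : sigma (odd_pos i) = odd_pos (sigma1 i).
Proof. by rewrite permE /sigma_fun odd_posK /= (mul2n i) odd_double. Qed.

Lemma sigma_even i : sigma (even_pos i) = even_pos (sigma2 i).
Proof. by rewrite permE /sigma_fun even_posK /= (mul2n i) odd_double. Qed.

Definition theta_pairing : {set {set 'I_(2 * m)}} :=
  [set [set odd_pos i; even_pos (theta i)] | i : 'I_m]%SET.

End Sigma.

Definition noncrossing_pairing (n : nat) (P : {set {set 'I_n}}) : Prop :=
  ~ exists a b c d : 'I_n,
      [/\ [set a; b]%SET \in P, [set c; d]%SET \in P
        & [&& (a < c)%N, (c < b)%N & (b < d)%N]].

Definition noncrossing (m : nat) (theta : {perm 'I_m}) : Prop :=
  noncrossing_pairing (theta_pairing theta).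

(* Tr_sigma^{(x) d1} (x) Tr_tau^{(x) d2}: the first d1 tensor factors use      *)
(* sigma, the last d2 use tau.                                                *)
Definition sigma_tau (m d1 d2 : nat) (theta : {perm 'I_m})
    (j : 'I_(d1 + d2)) : pperm (2 * m) :=
  if (j < d1)%N then perm_pperm (sigma theta) else tau (2 * m).

(* Main.v *)
(** Write each tensor leg index as a pair in [S * U], [S] for the [d1] legs
    contracted along sigma and [U] for the [d2] legs multiplied along tau. Up
    to the cyclic shift, sigma is the pairing of theta, so that with the
    positions 0, ..., 2m read as gaps between consecutive matrices, [A i]
    joins gap [i] to gap [(pi i).+1] in the [S] legs and to gap [i.+1] in the
    [U] legs. Let [F p q] be the sum over all gaps strictly between [p] and [q]
    of the product of the [A i] for [p <= i < q], seen as an operator on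
    [S * U]. If an interval stable under [pi] starts at [p] and [j = pi p],
    non-crossing splits it into two stable intervals, and
      F p q = A p * (1 (x) Tr_S (F (p+1) j * A j)) * F (j+1) q.
    A partial trace over [S] multiplies the norm by at most [#|S|], hence
    [F p q] has norm at most [#|S| ^ ((q - p) / 2)], and the final trace of
    [F 0 2m] contributes one more factor [#|S| = N ^ d1]. When all [A i] are
    the identity every step is an equality. *)

Require Import Defs.
From HB Require Import structures.
From mathcomp Require Import all_boot all_order all_algebra all_fingroup.
From mathcomp Require Import complex.
From mathcomp Require Import all_classical all_reals.
From mathcomp Require Import zify ring.

Set Implicit Arguments.
Unset Strict Implicit.
Unset Printing Implicit Defensive.

Import Order.TTheory GRing.Theory Num.Theory.

Local Open Scope ring_scope.

(** * Iterated sums over consecutive gaps *)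

Section IteratedSum.
Variables (C : comPzRingType) (T : finType).
Implicit Types (h : nat -> T) (f : (nat -> T) -> C).

Definition upd h k t : nat -> T := fun i => if i == k then t else h i.

(** Gaps [p.+1] to [p + l] are summed over; gap [p], like all others, keeps its value in [h]. Total
    functions on [nat] let sums over adjacent intervals be concatenated without casts. *)
Fixpoint sumr p l f h : C :=
  if l is l'.+1 then \sum_t sumr p.+1 l' f (upd h p.+1 t) else f h.

Lemma sumr_cat p a b f h :
  sumr p (a + b) f h = sumr p a (sumr (p + a) b f) h.
Proof.
elim: a p h => [|a IH] p h /=; first by rewrite addn0.
by apply: eq_bigr => t _; rewrite IH addSnnS.
Qed.

Lemma eq_sumr p l f f' h :
  (forall h',
    (forall k, ~~ (p < k <= p + l)%N -> h' k = h k) -> f h' = f' h') ->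
  sumr p l f h = sumr p l f' h.
Proof.
elim: l p h => [|l IH] p h eq_f /=; first exact: eq_f.
apply: eq_bigr => t _; apply: IH => h' eq_h; apply: eq_f => k kP.
by rewrite eq_h /upd; [case: eqP => // ?; lia | lia].
Qed.

Lemma sumr_local a p l f h h' :
  (forall h1 h2,
    (forall k, (a <= k <= p + l)%N -> h1 k = h2 k) -> f h1 = f h2) ->
  (forall k, (a <= k <= p)%N -> h k = h' k) ->
  sumr p l f h = sumr p l f h'.
Proof.
elim: l p h h' => [|l IH] p h h' f_loc eq_h /=.
  by apply: f_loc => k; rewrite addn0; apply: eq_h.
apply: eq_bigr => t _; apply: IH => [h1 h2 eq12|k kP].
  by apply: f_loc => k kP; apply: eq12; lia.
by rewrite /upd; case: eqP => // ?; apply: eq_h; lia.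
Qed.

Lemma sumrZ p l c f h :
  sumr p l (fun h => c * f h) h = c * sumr p l f h.
Proof.
elim: l p h => [|l IH] p h //=; rewrite big_distrr /=.
by apply: eq_bigr => t _; apply: IH.
Qed.

Lemma sumr_sum (I : finType) p l (f : I -> (nat -> T) -> C) h :
  sumr p l (fun h => \sum_i f i h) h = \sum_i sumr p l (f i) h.
Proof.
elim: l p h => [|l IH] p h //=; rewrite exchange_big /=.
by apply: eq_bigr => t _; apply: IH.
Qed.

End IteratedSum.

Lemma big_pair (C : nmodType) (S U : finType) (F : S * U -> C) :
  \sum_t F t = \sum_s \sum_u F (s, u).
Proof. by rewrite pair_bigA; apply: eq_bigr => -[]. Qed.

(** * Transfer operators of intervals and their recursion *)

Section Transfer.
Variables (C : comPzRingType) (S U : finType).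
Local Notation T := (S * U)%type.
Variables (A : nat -> T -> T -> C) (pi : nat -> nat).

(* The partial trace Tr_S G. *)
Definition ptrop (G : (T -> C) -> T -> C) (x : U -> C) (u : U) : C :=
  \sum_s G (fun t => (t.1 == s)%:R * x t.2) (s, u).

Definition kapply (B : T -> T -> C) (x : T -> C) (t : T) : C :=
  \sum_t' B t t' * x t'.

Definition weight p q (h : nat -> T) : C :=
  \prod_(p <= i < q) A i (h i) ((h (pi i).+1).1, (h i.+1).2).

(* The operator F p q of the header. Applying it to a vector, so that the gap
   [q] is summed over as well, avoids a separate clause for [p = q], where its
   kernel is a Kronecker delta. *)
Definition transfer p q (x : T -> C) (t : T) : C :=
  sumr p (q - p) (fun h => weight p q h * x (h q)) (fun=> t).

Definition stable p q := forall i, (p <= i < q)%N -> (p <= pi i < q)%N.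

Lemma weight_local p q h1 h2 : stable p q ->
  (forall k, (p <= k <= q)%N -> h1 k = h2 k) -> weight p q h1 = weight p q h2.
Proof.
move=> st eq12; apply: eq_big_nat => i ipq; have := st i ipq => piq.
by rewrite !eq12 //; lia.
Qed.

(** On a stable interval the weight reads only gaps [p] to [q], so the history matters only through
    [h p]. Inner sums of a larger history thus become transfers. *)
Lemma transferE p q x h : (p <= q)%N -> stable p q ->
  sumr p (q - p) (fun h => weight p q h * x (h q)) h = transfer p q x (h p).
Proof.
move=> lepq st; apply: (@sumr_local _ _ p) => [h1 h2 eq12|k kP].
  rewrite (@weight_local _ _ h1 h2 st) => [|k kP]; last by apply: eq12; lia.
  by rewrite eq12 //; lia.
by congr h; lia.
Qed.

Lemma transfer_sum (I : finType) p q (c : I -> C) (x : I -> T -> C) t :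
  transfer p q (fun t => \sum_i x i t * c i) t =
    \sum_i transfer p q (x i) t * c i.
Proof.
rewrite /transfer; under [RHS]eq_bigr do rewrite mulrC -sumrZ.
rewrite -sumr_sum; apply: eq_sumr => h _; rewrite mulr_sumr.
by apply: eq_bigr => i _; ring.
Qed.

Lemma eq_transfer p q x y : x =1 y -> transfer p q x =1 transfer p q y.
Proof. by move=> xy t; apply: eq_sumr => h _; rewrite xy. Qed.

Lemma kapply_delta (B : T -> T -> C) s (x : U -> C) t :
  kapply B (fun t => (t.1 == s)%:R * x t.2) t = \sum_u B t (s, u) * x u.
Proof.
rewrite /kapply big_pair (bigD1 s) //= [X in _ + X]big1 ?addr0.
  by apply: eq_bigr => u _; rewrite eqxx mul1r.
by move=> s' /negPf ->; rewrite big1 // => u _; rewrite mul0r mulr0.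
Qed.

Lemma transfer_nil p x : transfer p p x =1 x.
Proof. by move=> t; rewrite /transfer subnn /= /weight big_geq ?mul1r. Qed.

Lemma transfer_rec p q x t :
  let j := pi p in
  (p < j < q)%N -> pi j = p -> stable p.+1 j -> stable j.+1 q ->
  transfer p q x t =
    kapply (A p) (fun t1 =>
      ptrop (fun y => transfer p.+1 j (kapply (A j) y))
            (fun u => transfer j.+1 q x (t1.1, u)) t1.2) t.
Proof.
move=> j /andP[ltpj ltjq] pij st1 st2.
(* [t1] is the value at gap [p.+1] and [t2] the one at gap [j.+1]. As [pi] swaps [p] and [j], the
   column indices of [A p] and [A j] have their [S] parts exchanged. *)
have -> : transfer p q x t = \sum_t1 \sum_t2
    A p t (t2.1, t1.2) * transfer j.+1 q x t2 *
      transfer p.+1 j (fun t => A j t (t1.1, t2.2)) t1.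
  (* The summed gaps are [p.+1], then [p.+2] to [j], then [j.+1], then the rest up to [q]. *)
  rewrite /transfer; have -> : (q - p = (j - p.+1 + (q - j.+1).+1).+1)%N by lia.
  rewrite [LHS]/=; apply: eq_bigr => t1 _; rewrite sumr_cat subnKC //=.
  rewrite (@eq_sumr _ _ _ _ _ (fun h => \sum_t2
      A p t (t2.1, t1.2) * transfer j.+1 q x t2 *
        (weight p.+1 j h * A j (h j) (t1.1, t2.2)))); last first.
    move=> h eq_h; apply: eq_bigr => t2 _.
    have hp : h p = t.
      by rewrite eq_h; [rewrite /upd; case: eqP => //; lia | lia].
    have hp1 : h p.+1 = t1 by rewrite eq_h; [rewrite /upd eqxx | lia].
    rewrite -[t2 in transfer _ _ _ t2](_ : upd h j.+1 t2 j.+1 = _); last first.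
      by rewrite /upd eqxx.
    rewrite -transferE // mulrAC -sumrZ; apply: eq_sumr => h' eq_h'.
    have eqh k : (k <= j)%N -> h' k = h k.
      by move=> lekj; rewrite eq_h' /upd; [case: eqP => //|]; lia.
    have h'j1 : h' j.+1 = t2 by rewrite eq_h'; [rewrite /upd eqxx | lia].
    (* The inner weight reads gaps up to [j] only, so it is constant in the sum over the gaps after
       [j.+1]. *)
    rewrite -(@weight_local p.+1 j h' h st1); last first.
      by move=> k ?; apply: eqh; lia.
    rewrite -(eqh j) //.
    rewrite /weight (@big_cat_nat _ _ _ j) /=; [|lia|lia].
    rewrite big_ltn // (@big_ltn _ _ _ j) //= -/j pij.
    rewrite (eqh p) 1?ltnW // (eqh p.+1) // h'j1 hp hp1; ring.
  rewrite sumr_sum; apply: eq_bigr => t2 _; rewrite sumrZ.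
  rewrite (@transferE p.+1 j (fun t => A j t (t1.1, t2.2))) //.
  by rewrite /upd eqxx.
rewrite [RHS](eq_bigr (fun t1 => \sum_s \sum_u A p t (t1.1, t1.2) *
    transfer j.+1 q x (t1.1, u) *
    transfer p.+1 j (fun t => A j t (s, u)) (s, t1.2))); last first.
  move=> [s' u] _ /=; rewrite mulr_sumr; apply: eq_bigr => s _.
  rewrite (eq_transfer _ _ (kapply_delta (A j) s
    (fun u => transfer j.+1 q x (s', u)))) transfer_sum mulr_sumr.
  by apply: eq_bigr => u' _; ring.
(* With [t1 = (s, u)] and [t2 = (s', u')] both sides have the same terms; only the order of the four
   sums differs. *)
rewrite !big_pair.
under eq_bigr => s _ do under eq_bigr => u _ do rewrite big_pair.
under eq_bigr => s _ do rewrite exchange_big /=.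
rewrite exchange_big /=; apply: eq_bigr => s' _.
by rewrite exchange_big.
Qed.

End Transfer.

(** * Non-crossing pairings and induction on stable intervals *)

Definition nc_pairing n (pi : nat -> nat) :=
  [/\ forall i, (i < n)%N -> pi (pi i) = i,
      forall i, (i < n)%N -> pi i != i
    & forall a c, (c < n)%N -> (pi c < n)%N ->
        ~~ [&& (a < c)%N, (c < pi a)%N & (pi a < pi c)%N]].

Section Noncrossing.
Variables (n : nat) (pi : nat -> nat).
Hypothesis pi_nc : nc_pairing n pi.

(** A pair with one end in each piece would cross the pair of [p] and [pi p]; involutivity keeps
    other positions from being matched to these two ends. *)
Lemma stable_split p q : (p < q <= n)%N -> stable pi p q ->
  [/\ (p < pi p < q)%N, pi (pi p) = p, stable pi p.+1 (pi p)
    & stable pi (pi p).+1 q].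
Proof.
case: pi_nc => piK pi_neq nc /andP[ltpq leqn] st.
have piKp := piK p (leq_trans ltpq leqn).
have stp : (p <= pi p < q)%N by apply: st; rewrite leqnn.
have np := pi_neq p (leq_trans ltpq leqn).
split=> // [|i iP|i iP]; first by lia.
- have sti : (p <= pi i < q)%N by apply: st; lia.
  have iK : pi (pi i) = i by apply: piK; lia.
  have ni : pi i != p by apply/eqP => e; move: iK; rewrite e; lia.
  have nj : pi i != pi p by apply/eqP => e; move: iK; rewrite e; lia.
  have := nc p i; lia.
- have sti : (p <= pi i < q)%N by apply: st; lia.
  have iK : pi (pi i) = i by apply: piK; lia.
  have ni : pi i != p by apply/eqP => e; move: iK; rewrite e; lia.
  have nj : pi i != pi p by apply/eqP => e; move: iK; rewrite e; lia.
  (* Here [i] would be the right end of a crossing pair, so non-crossing is applied to its left end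
     [pi i]. *)
  have := nc p (pi i); rewrite iK; lia.
Qed.

(** Serves both the exact value for identity matrices and the norm bound. *)
Lemma stable_ind (P : nat -> nat -> Prop) :
  (forall p, P p p) ->
  (forall p q, (p < pi p < q)%N -> pi (pi p) = p ->
    stable pi p.+1 (pi p) -> stable pi (pi p).+1 q ->
    P p.+1 (pi p) -> P (pi p).+1 q -> P p q) ->
  forall p q, (p <= q <= n)%N -> stable pi p q -> P p q.
Proof.
move=> P0 PS p q; have [l] := ubnP (q - p)%N.
elim: l => // l IH in p q * => ltl /andP[lepq leqn] st.
move: lepq; rewrite leq_eqVlt => /predU1P[->//|ltpq].
have [|jP jK st1 st2] := @stable_split p q _ st; first by lia.
by apply: PS => //; apply: IH => //; lia.
Qed.

Section Scalar.
Variables (C : comPzRingType) (S U : finType).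

(** Each pair closes one free loop over [S], worth a factor [#|S|]; [k] counts the pairs. *)
Lemma transfer_id p q (A := fun=> fun t t' : S * U => (t == t')%:R : C) :
  (p <= q <= n)%N -> stable pi p q -> exists2 k, (q - p = 2 * k)%N &
  forall x, transfer A pi p q x =1 fun t => #|S|%:R ^+ k * x t.
Proof.
have kapply_id i x : kapply (A i) x =1 x.
  move=> t; rewrite /kapply (bigD1 t) //= [X in _ + X]big1 ?addr0.
    by rewrite /A eqxx mul1r.
  by move=> t' /negPf; rewrite /A eq_sym => ->; rewrite mul0r.
move: p q; apply: stable_ind => [p|p q jP jK st1 st2 [k1 e1 H1] [k2 e2 H2]].
  by exists 0; [lia|move=> x t; rewrite transfer_nil mul1r].
exists (k1 + k2).+1; first by lia.
move=> x t; rewrite transfer_rec // kapply_id /ptrop.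
(* The delta is one at the traced index, so all [s] contribute equally. *)
rewrite (eq_bigr (fun=> #|S|%:R ^+ (k1 + k2) * x t)).
  by rewrite sumr_const exprS -mulrA mulr_natl.
move=> s _; rewrite H1 kapply_id /= eqxx mul1r H2.
by case: t => s' u; rewrite exprD mulrA.
Qed.

End Scalar.

(** * Norm bounds for transfer operators *)

Section Norm.
Variables (C : numDomainType) (S U : finType).

Definition normsq (T : finType) (x : T -> C) : C := \sum_t `|x t| ^+ 2.

Lemma normsq_ge0 (T : finType) (x : T -> C) : 0 <= normsq x.
Proof. by apply: sumr_ge0 => t _; rewrite exprn_ge0. Qed.

Lemma normsq_pair (x : S * U -> C) :
  normsq x = \sum_s normsq (fun u => x (s, u)).
Proof. exact: big_pair. Qed.

(** Cauchy-Schwarz against the all-ones vector. *)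
Lemma sqr_norm_sum (x : S -> C) : `|\sum_s x s| ^+ 2 <= #|S|%:R * normsq x.
Proof.
apply: (@le_trans _ _ ((\sum_s `|x s|) ^+ 2)).
  by rewrite ler_sqr ?nnegrE ?sumr_ge0 // ler_norm_sum.
(* Once doubled, the inequality is a double sum of instances of [2ab <= a^2 + b^2]. *)
rewrite -(@ler_pMn2r _ 2) // expr2 mulr_suml.
rewrite [leRHS](_ : _ =
    \sum_s \sum_s' (`|x s| ^+ 2 + `|x s'| ^+ 2)); last first.
  under [RHS]eq_bigr do rewrite big_split /= sumr_const.
  by rewrite big_split /= sumr_const sumrMnl mulr_natl -mulr2n.
rewrite -sumrMnl; apply: ler_sum => s _; rewrite mulr_sumr -sumrMnl.
apply: ler_sum => s' _; rewrite -subr_ge0.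
have -> : `|x s| ^+ 2 + `|x s'| ^+ 2 - `|x s| * `|x s'| *+ 2 =
    (`|x s| - `|x s'|) ^+ 2.
  by ring.
by rewrite real_exprn_even_ge0 // rpredB // normr_real.
Qed.

(** One factor [#|S|] comes from Cauchy-Schwarz over [s], the other from adding up [#|S|] test
    vectors, each a copy of [x] placed in slice [s]. *)
Lemma normsq_ptrop c (G : (S * U -> C) -> S * U -> C) x :
  (forall y, normsq (G y) <= c * normsq y) ->
  normsq (ptrop G x) <= #|S|%:R ^+ 2 * c * normsq x.
Proof.
move=> Gc; apply: (@le_trans _ _
  (\sum_u #|S|%:R * \sum_s `|G (fun t => (t.1 == s)%:R * x t.2) (s, u)| ^+ 2)).
  by apply: ler_sum => u _; apply: sqr_norm_sum.
rewrite -mulr_sumr exchange_big /= expr2 -2!mulrA ler_wpM2l //.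
rewrite mulr_natl -sumr_const; apply: ler_sum => s _.
have -> : normsq x = normsq (fun t : S * U => (t.1 == s)%:R * x t.2).
  rewrite normsq_pair (bigD1 s) //= [X in _ + X]big1 ?addr0.
    by apply: eq_bigr => u _; rewrite eqxx mul1r.
  move=> s' /negPf /= neq; rewrite /normsq big1 // => u _.
  by rewrite neq mul0r normr0 expr0n.
(* Only slice [s] of the output is used; the other slices have nonnegative squared norm and are
   dropped. *)
apply: le_trans (Gc _); rewrite normsq_pair (bigD1 s) //= lerDl.
by apply: sumr_ge0 => s' _; apply: normsq_ge0.
Qed.

(** Each pair occupies two positions and costs [#|S| ^ 2] in squared norm, whence the exponent
    [q - p]. *)
Lemma normsq_transfer (A : nat -> S * U -> S * U -> C) p q :
  (forall i x, normsq (kapply (A i) x) <= normsq x) ->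
  (p <= q <= n)%N -> stable pi p q ->
  forall x, normsq (transfer A pi p q x) <= #|S|%:R ^+ (q - p) * normsq x.
Proof.
move=> Ac; move: p q; apply: stable_ind => [p|p q jP jK st1 st2 H1 H2] x.
  by rewrite subnn mul1r /normsq; under eq_bigr do rewrite transfer_nil.
rewrite [leLHS](eq_bigr _ (fun t _ => congr1 (fun z => `|z| ^+ 2)
  (transfer_rec A x t jP jK st1 st2))).
(* Once the contraction [A p] is removed, the partial trace acts on the [U] legs separately for each
   [S] index. *)
apply: le_trans (Ac _ _) _; rewrite normsq_pair.
have -> : (q - p = 2 + (pi p - p.+1) + (q - (pi p).+1))%N by lia.
rewrite !exprD -mulrA; apply: le_trans (ler_wpM2l _ (H2 x)).
  rewrite normsq_pair mulr_sumr; apply: ler_sum => s _.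
  apply: normsq_ptrop => y; apply: le_trans (H1 _) _.
  by rewrite ler_wpM2l // exprn_ge0.
by rewrite mulr_ge0 // exprn_ge0.
Qed.

End Norm.
End Noncrossing.

(** * The pairing of theta and its relation to sigma *)

Section Pairing.
Variables (m : nat) (theta : {perm 'I_m}).
Local Notation n := (2 * m)%N.

Definition pairing (p : 'I_n) : 'I_n :=
  if odd p then odd_pos ((theta^-1)%g (half_pos p))
  else even_pos (theta (half_pos p)).

Lemma odd_odd_pos (i : 'I_m) : odd (odd_pos i) = false.
Proof. by rewrite /= mul2n odd_double. Qed.

Lemma odd_even_pos (i : 'I_m) : odd (even_pos i).
Proof. by rewrite /= mul2n odd_double. Qed.

Lemma pairingK : involutive pairing.
Proof.
move=> p; rewrite {2}/pairing [RHS]half_posK; case: ifP => pP; rewrite /pairing.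
  by rewrite odd_odd_pos odd_posK permKV.
by rewrite odd_even_pos even_posK permK.
Qed.

Lemma odd_pairing p : odd (pairing p) = ~~ odd p.
Proof. by rewrite /pairing; case: ifP; rewrite ?odd_odd_pos ?odd_even_pos. Qed.

(** On [odd_pos i] the shift in [sigma1] leads from the partner [even_pos (theta i)] to the next
    position, cyclically. On an even position the partner is some [odd_pos k], directly followed by
    [even_pos k]. *)
Lemma sigmaE p : sigma theta p = ((pairing p).+1 %% n)%N :> nat.
Proof.
rewrite permE /sigma_fun /pairing; case: ifP => _; last first.
  by rewrite sigma1E /= muln_modr mulnS.
rewrite /sigma2 /= modn_small // -[leqRHS]/(2 * m)%N.
by case: (_ (half_pos p)) => /= i; lia.
Qed.

Lemma pairing_mem p : [set p; pairing p]%SET \in theta_pairing theta.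
Proof.
rewrite [X in [set X; _]%SET]half_posK /pairing; case: ifP => _; last first.
  exact: imset_f.
by rewrite finset.setUC -{2}[half_pos p](permKV theta); apply: imset_f.
Qed.

Variable i0 : 'I_n.

(* [npairing i] is junk for [i >= n]. *)
Definition npairing (i : nat) : nat := pairing (insubd i0 i).

Lemma npairing_lt i : (npairing i < n)%N. Proof. exact: ltn_ord. Qed.

Lemma npairingE (i : 'I_n) : npairing i = pairing i.
Proof. by rewrite /npairing valKd. Qed.

Lemma nc_npairing : noncrossing theta -> nc_pairing n npairing.
Proof.
move=> nc; split=> [i ltin|i ltin|a c ltcn _].
- by rewrite /npairing valKd pairingK insubdK.
- apply/eqP => e; have := odd_pairing (insubd i0 i).
  by move: e; rewrite /npairing => ->; rewrite insubdK //; case: odd.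
- apply/negP => /and3P[ltac ltcb ltbd]; apply: nc.
  exists (insubd i0 a), (pairing (insubd i0 a)).
  exists (insubd i0 c), (pairing (insubd i0 c)).
  have ltan := ltn_trans ltac ltcn.
  split; [exact: pairing_mem..|].
  by rewrite !insubdK // ltac ltcb.
Qed.

End Pairing.

(** * Iterated sums as sums over finite functions *)

Lemma big_ffunS (C : nmodType) (T : finType) l (F : {ffun 'I_l.+1 -> T} -> C) :
  \sum_x F x = \sum_t \sum_(x : {ffun 'I_l -> T})
    F [ffun i => if unlift ord0 i is Some j then x j else t].
Proof.
rewrite pair_bigA.
apply: (reindex (fun p : T * {ffun 'I_l -> T} =>
  [ffun i => if unlift ord0 i is Some j then p.2 j else p.1])).
exists (fun x : {ffun 'I_l.+1 -> T} =>
  (x ord0, [ffun j : 'I_l => x (lift ord0 j)])) => [[t x]|x] _.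
  congr pair; first by rewrite ffunE unlift_none.
  by apply/ffunP => j; rewrite !ffunE liftK.
by apply/ffunP => i; rewrite ffunE; case: unliftP => [j|] -> //; rewrite ffunE.
Qed.

(** The first summed gap is [p.+1], hence the index [k' - p] at gap [k'.+1]. *)
Lemma sumr_ffun (C : comPzRingType) (T : finType) p l (f : (nat -> T) -> C) h :
  sumr p l f h = \sum_(x : {ffun 'I_l -> T})
    f (fun k => if k is k'.+1 then
                  if (p <= k')%N then oapp x (h k) (insub (k' - p)%N) else h k
                else h k).
Proof.
elim: l p h => [|l IH] p h /=.
  rewrite (bigD1 [ffun i => h 0%N]) //= big1 ?addr0 => [|x /eqP[]].
    congr f; apply: funext => -[|k] //; case: ifP => // _.
    by rewrite insubF.
  by apply/ffunP => -[].
rewrite big_ffunS; apply: eq_bigr => t _; rewrite IH; apply: eq_bigr => x _.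
congr f; apply: funext => -[|k]; first by rewrite /upd.
rewrite /upd eqSS; case: (ltngtP p k) => [ltpk|ltkp|->].
- have -> : (k - p = (k - p.+1).+1)%N by lia.
  case: insubP => [i _ iE|]; last first.
    by rewrite -leqNgt => le; rewrite insubF //= ltnS ltnNge le.
  have lti : ((k - p.+1).+1 < l.+1)%N by rewrite ltnS -iE ltn_ord.
  rewrite insubT /= ffunE; case: unliftP => [j [/= e]|/(congr1 val)//].
  by congr (x _); apply: val_inj; rewrite /= iE; move: e; rewrite /bump; lia.
- by [].
- by rewrite subnn insubT /= ffunE; case: unliftP => // j /(congr1 val).
Qed.

(** * Separating the legs of sigma from those of tau *)

Section Legs.
Variables (N d1 d2 : nat).
Local Notation S := (midx N 'I_d1).
Local Notation U := (midx N 'I_d2).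
Local Notation V := (midx N 'I_(d1 + d2)).

Definition join_legs (t : S * U) : V :=
  [ffun j : 'I_(d1 + d2) => match fintype.split j with
                            | inl j1 => t.1 j1
                            | inr j2 => t.2 j2
                            end].

Definition split_legs (x : V) : S * U :=
  ([ffun j => x (lshift d2 j)], [ffun j => x (rshift d1 j)]).

Lemma join_legs_l t j : join_legs t (lshift d2 j) = t.1 j.
Proof. by rewrite ffunE (fintype.unsplitK (inl j)). Qed.

Lemma join_legs_r t j : join_legs t (rshift d1 j) = t.2 j.
Proof. by rewrite ffunE (fintype.unsplitK (inr j)). Qed.

Lemma join_legsK : cancel join_legs split_legs.
Proof.
by case=> s u; congr pair; apply/ffunP => j;
  rewrite ffunE ?join_legs_l ?join_legs_r.
Qed.

Lemma split_legsK : cancel split_legs join_legs.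
Proof.
move=> x; apply/ffunP => j; rewrite -(fintype.splitK j).
by case: (fintype.split j) => i; rewrite ?join_legs_l ?join_legs_r ffunE.
Qed.

Lemma join_legs_bij : bijective join_legs.
Proof. exact: Bijective join_legsK split_legsK. Qed.

Definition tens_rank (t : S * U) : 'I_#|V| := enum_rank (join_legs t).

Lemma tens_rank_bij : bijective tens_rank.
Proof. by apply: bij_comp join_legs_bij; apply: enum_rank_bij. Qed.

(* The index type of the rows (or columns) of the partial trace: the legs of  *)
(* the last [d2] tensor factors at the single position [e].                   *)
Section Boundary.
Variables (n : nat) (P : pred ('I_n * 'I_(d1 + d2))) (e : 'I_n) (s0 : S).
Hypothesis PE : forall p, P p = (p.1 == e) && (d1 <= p.2)%N.

(** [s0] is a filler for the first [d1] legs; pairs satisfying [P] have a later leg and read [u]. *)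
Definition boundary_idx (u : U) : midx N {p | P p} :=
  [ffun p => join_legs (s0, u) (val p).2].

Lemma boundary_pos j : P (e, rshift d1 j).
Proof. by rewrite PE eqxx leq_addr. Qed.

Lemma boundary_posE (p : {p | P p}) :
  exists j, p = exist _ (e, rshift d1 j) (boundary_pos j).
Proof.
case: p => -[i j] Pij; have := Pij; rewrite PE /= => /andP[/eqP ie].
rewrite -{1}(fintype.splitK j).
case: (fintype.split j) (fintype.splitK j) => j' /= jE.
  by rewrite leqNgt ltn_ord.
by move=> _; exists j'; apply: val_inj; rewrite /= jE ie.
Qed.

Lemma boundary_idxE u j (p := exist _ (e, rshift d1 j) (boundary_pos j)) :
  boundary_idx u p = u j.
Proof. by rewrite ffunE join_legs_r. Qed.

Lemma boundary_bij : bijective boundary_idx.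
Proof.
exists (fun a : midx N {p | P p} =>
  [ffun j => a (exist _ (e, rshift d1 j) (boundary_pos j))]) => [u|a].
  by apply/ffunP => j; rewrite ffunE boundary_idxE.
apply/ffunP => p; have [j ->] := boundary_posE p.
by rewrite boundary_idxE ffunE.
Qed.

End Boundary.
End Legs.

Definition history (T : Type) l (t : T) (w : 'I_l -> T) (k : nat) : T :=
  if k is k'.+1 then oapp w t (insub k') else t.

Arguments history : simpl never.

Lemma historyS (T : Type) l (t : T) (w : 'I_l -> T) (i : 'I_l) :
  history t w i.+1 = w i.
Proof. by rewrite /history valK. Qed.

Lemma transfer0E (C : comPzRingType) (S U : finType)
    (A : nat -> S * U -> S * U -> C) pi l x t :
  transfer A pi 0 l x t = \sum_(w : {ffun 'I_l -> S * U})
    weight A pi 0 l (history t w) * x (history t w l).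
Proof.
rewrite /transfer sumr_ffun subn0; apply: eq_bigr => w _.
have -> : history t w = fun k => if k is k'.+1 then
    if (0 <= k')%N then oapp w t (insub (k' - 0)%N) else t else t.
  by apply: funext => -[|k] //=; rewrite subn0.
by [].
Qed.

(** * The partial trace as a trace of transfer operators *)

Section PtraceTransfer.
Variables (R : realType) (m N d1 d2 : nat) (theta : {perm 'I_m}).
Local Notation n := (2 * m)%N.
Local Notation S := (midx N 'I_d1).
Local Notation U := (midx N 'I_d2).
Local Notation rho := (@sigma_tau m d1 d2 theta).
Variables (m_gt0 : (0 < m)%N) (s0 : S).

Lemma double_gt0 : (0 < n)%N. Proof. by rewrite muln_gt0. Qed.
Lemma double_pred_lt : (n.-1 < n)%N.
Proof. by rewrite prednK // double_gt0. Qed.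

Definition first_pos : 'I_n := Ordinal double_gt0.
Definition last_pos : 'I_n := Ordinal double_pred_lt.

Lemma sigma_tau_l j : rho (lshift d2 j) = perm_pperm (sigma theta).
Proof. by rewrite /sigma_tau /= ltn_ord. Qed.

Lemma sigma_tau_r j : rho (rshift d1 j) = tau n.
Proof. by rewrite /sigma_tau /= ltnNge leq_addr. Qed.

Lemma pim_tau : pim (tau n) = [set~ first_pos]%SET.
Proof.
apply/setP => i; rewrite !inE; apply/existsP/idP => [[i' /eqP /= e]|ni].
  apply/eqP => i0; move: e; rewrite i0; case: insubP => // u _ uE [uf].
  by move: uE; rewrite uf.
have lt0i : (0 < i)%N.
  by rewrite lt0n; apply: contraNneq ni => e; apply/eqP/val_inj.
exists (Ordinal (leq_ltn_trans (leq_pred i) (ltn_ord i))) => /=.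
by apply/eqP; rewrite prednK // valK.
Qed.

Lemma pdom_tau : pdom (tau n) = [set~ last_pos]%SET.
Proof.
apply/setP => i; rewrite !inE /=; have [lti|lei] := ltnP i.+1 n.
  rewrite insubT; apply/esym/eqP => e; move: lti; rewrite e /=.
  by rewrite prednK ?ltnn ?double_gt0.
rewrite insubF ?ltnNge ?lei //; apply/esym/negbTE/negPn/eqP/val_inj => /=.
by have := ltn_ord i; lia.
Qed.

Lemma tr_rowE (p : 'I_n * 'I_(d1 + d2)) :
  (p.1 \notin pim (rho p.2)) = (p.1 == first_pos) && (d1 <= p.2)%N.
Proof.
case: p => i j /=.
rewrite -(fintype.splitK j); case: (fintype.split j) => j' /=.
  rewrite sigma_tau_l leqNgt ltn_ord andbF; apply/negbTE/negPn.
  rewrite inE; apply/existsP; exists ((sigma theta)^-1%g i).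
  by rewrite /= permKV.
by rewrite sigma_tau_r pim_tau !inE negbK leq_addr andbT.
Qed.

Lemma tr_colE (p : 'I_n * 'I_(d1 + d2)) :
  (p.1 \notin pdom (rho p.2)) = (p.1 == last_pos) && (d1 <= p.2)%N.
Proof.
case: p => i j /=.
rewrite -(fintype.splitK j); case: (fintype.split j) => j' /=.
  by rewrite sigma_tau_l leqNgt ltn_ord andbF inE.
by rewrite sigma_tau_r pdom_tau !inE negbK leq_addr andbT.
Qed.

Definition row_idx : U -> midx N (Defs.tr_row rho) :=
  @boundary_idx N d1 d2 n (fun p => p.1 \notin pim (rho p.2)) s0.
Definition col_idx : U -> midx N (Defs.tr_col rho) :=
  @boundary_idx N d1 d2 n (fun p => p.1 \notin pdom (rho p.2)) s0.

Definition row_rank u : 'I_#|midx N (Defs.tr_row rho)| := enum_rank (row_idx u).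
Definition col_rank u : 'I_#|midx N (Defs.tr_col rho)| := enum_rank (col_idx u).

Lemma row_rank_bij : bijective row_rank.
Proof. exact: bij_comp (@enum_rank_bij _) (boundary_bij _ tr_rowE). Qed.

Lemma col_rank_bij : bijective col_rank.
Proof. exact: bij_comp (@enum_rank_bij _) (boundary_bij _ tr_colE). Qed.

Lemma tr_compatP (u u' : U) (r c : midx N ('I_n * 'I_(d1 + d2))%type) : reflect
  [/\ forall i j, c (i, lshift d2 j) = r (sigma theta i, lshift d2 j),
      forall (i i' : 'I_n) j, i' = i.+1 :> nat ->
        c (i, rshift d1 j) = r (i', rshift d1 j),
      forall j, r (first_pos, rshift d1 j) = u j
    & forall j, c (last_pos, rshift d1 j) = u' j]
  (tr_compat (row_idx u) (col_idx u') r c).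
Proof.
apply: (iffP and3P) => [[/forallP H1 /forallP H2 /forallP H3]|[H1 H2 H3 H4]];
  split.
- move=> i j.
  have /forallP/(_ (sigma theta i))/forallP/(_ (lshift d2 j)) := H1 i.
  by rewrite sigma_tau_l /= eqxx => /eqP.
- move=> i i' j ii'; have /forallP/(_ i')/forallP/(_ (rshift d1 j)) := H1 i.
  by rewrite sigma_tau_r /= -ii' valK eqxx => /eqP.
- move=> j.
  have /eqP := H2 (exist _ (first_pos, rshift d1 j) (boundary_pos tr_rowE j)).
  by rewrite boundary_idxE.
- move=> j.
  have /eqP := H3 (exist _ (last_pos, rshift d1 j) (boundary_pos tr_colE j)).
  by rewrite boundary_idxE.
- apply/forallP => i; apply/forallP => i'; apply/forallP => j; apply/implyP.
  rewrite -(fintype.splitK j); case: (fintype.split j) => j' /=.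
    by rewrite sigma_tau_l /= => /eqP[<-]; rewrite H1.
  rewrite sigma_tau_r /=; case: insubP => // v _ vE /eqP[<-].
  by apply/eqP/esym/H2.
- apply/forallP => p; have [j ->] := boundary_posE tr_rowE p.
  by rewrite /row_idx boundary_idxE H3.
- apply/forallP => p; have [j ->] := boundary_posE tr_colE p.
  by rewrite /col_idx boundary_idxE H4.
Qed.

Definition block (B : tensmx R N (d1 + d2)) (t t' : S * U) : R[i] :=
  B (tens_rank t) (tens_rank t').

Variable A : 'I_n -> tensmx R N (d1 + d2).

Definition nblock (i : nat) := block (A (insubd first_pos i)).

Let pi := npairing theta first_pos.
Let T := (S * U)%type.

Definition row_of (h : nat -> T) : midx N ('I_n * 'I_(d1 + d2))%type :=
  [ffun p : 'I_n * 'I_(d1 + d2) => join_legs (h p.1) p.2].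

Definition col_of (h : nat -> T) : midx N ('I_n * 'I_(d1 + d2))%type :=
  [ffun p : 'I_n * 'I_(d1 + d2) =>
    join_legs ((h (pi p.1).+1).1, (h p.1.+1).2) p.2].

Lemma row_ofE h i j : row_of h (i, j) = join_legs (h i) j.
Proof. by rewrite ffunE. Qed.

Lemma col_ofE h i j :
  col_of h (i, j) = join_legs ((h (pi i).+1).1, (h i.+1).2) j.
Proof. by rewrite ffunE. Qed.

Lemma weight_rowcol h : weight nblock pi 0 n h =
  \prod_(i < n) A i (enum_rank [ffun j => row_of h (i, j)])
                    (enum_rank [ffun j => col_of h (i, j)]).
Proof.
rewrite /weight big_mkord; apply: eq_bigr => i _.
rewrite /nblock valKd /block; congr (A i (enum_rank _) (enum_rank _));
  by apply/ffunP => j; rewrite !ffunE.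
Qed.

(** [sigma] wraps around exactly when the partner is the last position; there gap [n] has to agree
    with gap [0] in the [S] legs, which is what tracing over [S] imposes. *)
Lemma history_sigma (h : nat -> T) (i : 'I_n) : (h n).1 = (h 0).1 ->
  (h (pi i).+1).1 = (h (sigma theta i)).1 :> S.
Proof.
move=> hn; rewrite sigmaE /pi npairingE.
have := ltn_ord (pairing theta i); rewrite leq_eqVlt => /predU1P[->|lt].
  by rewrite modnn.
by rewrite modn_small.
Qed.

(** Compatibility determines [c] from [r] and [u'], and the row indices [r] form a history; the
    terms correspond to histories from [(s, u)] that end in [(s, u')]. *)
Lemma ptrace_entry u u' :
  ptrace rho A (row_rank u) (col_rank u') =
  \sum_s transfer nblock pi 0 n (fun t => (t == (s, u'))%:R) (s, u).
Proof.
rewrite mxE !enum_rankK.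
under [RHS]eq_bigr do rewrite transfer0E.
rewrite [RHS]pair_bigA /=.
rewrite [RHS](eq_bigr (fun p : S * {ffun 'I_n -> T} =>
  if history (p.1, u) p.2 n == (p.1, u')
  then weight nblock pi 0 n (history (p.1, u) p.2) else 0)); last first.
  by move=> p _; case: eqP; rewrite ?mulr1 ?mulr0.
rewrite -[RHS]big_mkcond /=.
pose fwd (p : S * {ffun 'I_n -> T}) :=
  (row_of (history (p.1, u) p.2), col_of (history (p.1, u) p.2)).
pose M := midx N ('I_n * 'I_(d1 + d2))%type.
pose leg (rc : M * M) (i : 'I_n) := split_legs [ffun j => rc.1 (i, j)].
(* Gap [i.+1] is the row index of the next matrix; after the last one it is the initial [S] index
   with the column index [u']. *)
pose bwd rc : S * {ffun 'I_n -> T} := ((leg rc first_pos).1,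
  [ffun i : 'I_n => if insub i.+1 is Some i' then leg rc i'
           else ((leg rc first_pos).1, u')]).
have lastE (p : S * {ffun 'I_n -> T}) : history (p.1, u) p.2 n = p.2 last_pos.
  rewrite -(historyS (p.1, u)); congr (history _ _ _).
  by rewrite /= prednK // double_gt0.
have insub_last : insub last_pos.+1 = None :> option 'I_n.
  by rewrite insubF // /= prednK ?ltnn // double_gt0.
have bwd_last rc : history ((bwd rc).1, u) (bwd rc).2 n = ((bwd rc).1, u').
  by apply: etrans (lastE (bwd rc)) _; rewrite ffunE insub_last.
rewrite (reindex_onto fwd bwd); last first.
  move=> [r c] /tr_compatP /= [cl cr ru cu'].
  have histE (i : 'I_n) :
      history ((bwd (r, c)).1, u) (bwd (r, c)).2 i = leg (r, c) i.
    have [i0|i0] := posnP i.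
      rewrite i0 (_ : i = first_pos); last exact: val_inj.
      rewrite [RHS]surjective_pairing; congr pair.
      by apply/ffunP => j; rewrite !ffunE ru.
    have lti : (i.-1 < n)%N by exact: leq_ltn_trans (leq_pred i) (ltn_ord i).
    rewrite -(prednK i0) -[i.-1]/(val (Ordinal lti)) historyS ffunE /=.
    by rewrite prednK // valK.
  have h0 : history ((bwd (r, c)).1, u) (bwd (r, c)).2 0 = ((bwd (r, c)).1, u).
    by [].
  have := bwd_last (r, c); rewrite /fwd.
  move: h0 histE; move: (history _ _) => h h0 histE hn.
  have h1 : (h n).1 = (h 0).1 by rewrite hn h0.
  congr pair; apply/ffunP => -[i j]; rewrite ffunE /=.
    by rewrite histE split_legsK ffunE.
  rewrite history_sigma // -(fintype.splitK j).
  case: (fintype.split j) => j' /=.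
    by rewrite join_legs_l /= histE ffunE ffunE cl.
  rewrite join_legs_r /=; have [lti|lei] := ltnP i.+1 n.
    by rewrite (histE (Ordinal lti)) !ffunE; apply/esym/cr.
  have -> : i.+1 = n by have := ltn_ord i; lia.
  rewrite hn -cu'; congr (c (_, _)); apply: val_inj => /=.
  by have := ltn_ord i; lia.
(* The reindexed condition, compatibility together with [bwd] undoing [fwd], amounts to the history
   ending in [(s, u')]. *)
apply: eq_big => [[s w]|[s w] _]; last by rewrite weight_rowcol.
apply/andP/eqP => [[_ /eqP <-]|]; first by rewrite bwd_last.
move=> /= hn; set h := history (s, u) w in hn *.
have h1 : (h n).1 = (h 0).1 by rewrite hn.
split.
  apply/tr_compatP; split=> [i j|i i' j ii'|j|j]; rewrite ?col_ofE ?row_ofE.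
  - by rewrite !join_legs_l /= history_sigma.
  - by rewrite !join_legs_r /= ii'.
  - by rewrite !join_legs_r.
  - by rewrite !join_legs_r /= prednK ?hn // double_gt0.
have legE i : leg (fwd (s, w)) i = h i.
  rewrite -[h i]join_legsK; congr split_legs; apply/ffunP => j.
  by rewrite !ffunE.
apply/eqP; congr pair; first by rewrite legE.
apply/ffunP => i; rewrite ffunE -(historyS (s, u) w) -/h.
case: insubP => [i' _ <-|]; first by rewrite legE.
move=> lei; have -> : i.+1 = n by have := ltn_ord i; lia.
by rewrite legE hn.
Qed.

End PtraceTransfer.

(** * The operator norm as a supremum *)

Section OpNorm.
Variable R : realType.
Local Notation C := R[i].
Local Open Scope complex_scope.

Lemma l2norm_ge0 n (x : 'cV[C]_n) : 0 <= l2norm x.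
Proof. exact: sqrtr_ge0. Qed.

Lemma l2norm_sqr n (x : 'cV[C]_n) :
  (l2norm x ^+ 2)%:C = normsq (fun i => x i 0).
Proof.
rewrite sqr_sqrtr; last by apply: sumr_ge0 => i _; rewrite sqr_ge0.
by rewrite rmorph_sum; apply: eq_bigr => i _; rewrite rmorphXn.
Qed.

(** Passes from real norms to the squared norms in [R[i]] that the transfer estimates use. *)
Lemma l2norm_leP c p q (y : 'cV[C]_p) (x : 'cV[C]_q) : 0 <= c ->
  (l2norm y <= c * l2norm x) =
    (normsq (fun i => y i 0) <= c%:C ^+ 2 * normsq (fun i => x i 0)).
Proof.
move=> c0; rewrite -!l2norm_sqr -rmorphXn -rmorphM lecR -exprMn.
by rewrite ler_sqr ?nnegrE ?mulr_ge0 ?l2norm_ge0.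
Qed.

Lemma l2norm_eq c p q (y : 'cV[C]_p) (x : 'cV[C]_q) : 0 <= c ->
  normsq (fun i => y i 0) = c%:C ^+ 2 * normsq (fun i => x i 0) ->
  l2norm y = c * l2norm x.
Proof.
move=> c0; rewrite -!l2norm_sqr -rmorphXn -rmorphM => /complexI.
rewrite -exprMn => /(pexpIrn (isT : (0 < 2)%N)); apply;
  by rewrite nnegrE ?mulr_ge0 ?l2norm_ge0.
Qed.

Lemma l2norm_eq0 n (x : 'cV[C]_n) : l2norm x = 0 -> x = 0.
Proof.
move=> x0; have /esym := l2norm_sqr x; rewrite x0 expr0n /= => /eqP.
rewrite psumr_eq0 => [/allP x_eq0|i _]; last by rewrite exprn_ge0.
apply/matrixP => i j; rewrite ord1 mxE.
by have := x_eq0 i (mem_index_enum i); rewrite expf_eq0 normr_eq0 => /eqP.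
Qed.

Lemma l2norm0 n : l2norm (0 : 'cV[C]_n) = 0.
Proof.
rewrite /l2norm big1 ?sqrtr0 // => i _.
by rewrite mxE Normc.normc0 expr0n.
Qed.

Lemma l2normZ n (a : R) (x : 'cV[C]_n) :
  0 <= a -> l2norm (a%:C *: x) = a * l2norm x.
Proof.
move=> a0; have aE : Normc.normc a%:C = a.
  by rewrite /= expr0n addr0 sqrtr_sqr ger0_norm.
rewrite /l2norm -{2}(ger0_norm a0) -sqrtr_sqr -sqrtrM ?sqr_ge0 // mulr_sumr.
by under eq_bigr do rewrite mxE Normc.normcM aE exprMn.
Qed.

Lemma opnorm_le c p q (B : 'M[C]_(p, q)) : 0 <= c ->
  (forall x, l2norm (B *m x) <= c * l2norm x) -> opnorm B <= c.
Proof.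
move=> c0 Bc; apply: ge_sup => [|_ [x /= x1 <-]].
  by exists (l2norm (B *m 0)); exists 0; rewrite //= l2norm0.
by apply: le_trans (Bc x) _; rewrite ler_piMr.
Qed.

Lemma opnorm_bounded p q (B : 'M[C]_(p, q)) :
  has_ubound
    [set l2norm (B *m x) | x in [set x : 'cV[C]_q | l2norm x <= 1]]%classic.
Proof.
(* A crude bound: Cauchy-Schwarz in each row gives the factor [q], and each squared entry of [x] is
   at most its whole squared norm. *)
pose K : R := q%:R * \sum_i \sum_j Normc.normc (B i j) ^+ 2.
have K0 : 0 <= K.
  by rewrite mulr_ge0 //; do 2!(apply: sumr_ge0 => ? _); rewrite sqr_ge0.
exists (Num.sqrt K) => _ [x /= x1 <-].
rewrite -[Num.sqrt K]mulr1; apply: le_trans (ler_wpM2l (sqrtr_ge0 K) x1).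
rewrite l2norm_leP ?sqrtr_ge0 // -rmorphXn sqr_sqrtr // rmorphM rmorph_nat.
rewrite -mulrA rmorph_sum mulr_suml mulr_sumr; apply: ler_sum => i _.
rewrite mxE; apply: le_trans (sqr_norm_sum _) _; rewrite card_ord ler_wpM2l //.
rewrite rmorph_sum mulr_suml; apply: ler_sum => j _.
rewrite normrM exprMn rmorphXn ler_wpM2l ?exprn_ge0 //.
rewrite /normsq (bigD1 j) //= lerDl.
by apply: sumr_ge0 => k _; rewrite exprn_ge0.
Qed.

Lemma le_opnorm p q (B : 'M[C]_(p, q)) x :
  l2norm (B *m x) <= opnorm B * l2norm x.
Proof.
have [/eqP/l2norm_eq0 ->|x0] := boolP (l2norm x == 0).
  by rewrite mulmx0 !l2norm0 mulr0.
have lx : 0 < l2norm x by rewrite lt_def x0 l2norm_ge0.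
rewrite -ler_pdivrMr // mulrC -l2normZ ?invr_ge0 ?l2norm_ge0 // scalemxAr.
apply: ub_le_sup (opnorm_bounded B) _ _; exists ((l2norm x)^-1%:C *: x) => //=.
by rewrite l2normZ ?invr_ge0 ?l2norm_ge0 // mulVf.
Qed.

Lemma opnorm_eq c p q (B : 'M[C]_(p, q)) : 0 <= c -> (0 < q)%N ->
  (forall x, l2norm (B *m x) = c * l2norm x) -> opnorm B = c.
Proof.
move=> c0 q0 Bc; apply/le_anti.
rewrite opnorm_le //=; last by move=> x; rewrite Bc.
(* A unit vector, available since [0 < q], shows that [c] is reached. *)
pose x : 'cV[C]_q := \col_i (i == Ordinal q0)%:R.
have x1 : l2norm x = 1.
  rewrite /l2norm (bigD1 (Ordinal q0)) //= big1 => [|i /negPf i0].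
    by rewrite mxE eqxx Normc.normc1 expr1n addr0 sqrtr1.
  by rewrite mxE i0 Normc.normc0 expr0n.
by have := le_opnorm B x; rewrite Bc x1 !mulr1.
Qed.

Lemma normsq_col (T : finType) p (f : T -> 'I_p) (x : 'cV[C]_p) : bijective f ->
  normsq (fun i => x i 0) = normsq (fun t => x (f t) 0).
Proof. by move=> fb; rewrite /normsq (reindex f) //; apply: onW_bij. Qed.

End OpNorm.

(** * The bound for non-crossing theta and its attainment *)

Section NoncrossingTrace.
Variables (R : realType) (m N d1 d2 : nat) (theta : {perm 'I_m}).
Local Notation n := (2 * m)%N.
Local Notation S := (midx N 'I_d1).
Local Notation U := (midx N 'I_d2).
Local Notation rho := (@sigma_tau m d1 d2 theta).

Lemma kapply_block (B : tensmx R N (d1 + d2)) (v : 'cV_#|midx N 'I_(d1 + d2)|) :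
  kapply (block B) (fun t => v (tens_rank t) 0) =
    fun t => (B *m v) (tens_rank t) 0.
Proof.
apply: funext => t; rewrite mxE (reindex (@tens_rank N d1 d2)) //.
exact/onW_bij/tens_rank_bij.
Qed.

Lemma normsq_block (B : tensmx R N (d1 + d2)) (x : S * U -> R[i]) :
  opnorm B <= 1 -> normsq (kapply (block B) x) <= normsq x.
Proof.
move=> B1; have [g gK Kg] := tens_rank_bij N d1 d2.
pose v : 'cV[R[i]]_#|midx N 'I_(d1 + d2)| := \col_i x (g i).
have -> : x = fun t => v (tens_rank t) 0 by apply: funext => t; rewrite mxE gK.
rewrite kapply_block -!(normsq_col _ (tens_rank_bij N d1 d2)).
have : l2norm (B *m v) <= 1 * l2norm v.
  by apply: le_trans (le_opnorm _ _) _; rewrite ler_wpM2r // l2norm_ge0.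
by rewrite l2norm_leP // expr1n mul1r.
Qed.

Variables (m_gt0 : (0 < m)%N) (s0 : S).

Local Notation row := (@row_rank m N d1 d2 theta s0).
Local Notation col := (@col_rank m N d1 d2 theta s0).
Local Notation pi := (npairing theta (first_pos m_gt0)).

Let row_bij : bijective row := @row_rank_bij m N d1 d2 theta m_gt0 s0.
Let col_bij : bijective col := @col_rank_bij m N d1 d2 theta m_gt0 s0.

Lemma ptrace_mulmx (A : 'I_n -> tensmx R N (d1 + d2))
    (v : 'cV[R[i]]_#|midx N (Defs.tr_col rho)|) u :
  (ptrace rho A *m v) (row u) 0 =
  ptrop (transfer (nblock m_gt0 A) pi 0 n) (fun u' => v (col u') 0) u.
Proof.
rewrite mxE (reindex col) /=; last exact/onW_bij/col_bij.
under eq_bigr do rewrite (ptrace_entry _ m_gt0) mulr_suml.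
rewrite exchange_big; apply: eq_bigr => s _ /=; rewrite -transfer_sum.
(* The sum of basis vectors over the columns is the test vector carrying [v] in slice [s]. *)
apply: eq_transfer => -[s' u'] /=; rewrite (bigD1 u') //= big1 ?addr0.
  by rewrite xpair_eqE eqxx andbT.
by move=> w /negPf wu; rewrite xpair_eqE (eq_sym u') wu andbF mul0r.
Qed.

Lemma stable_npairing : stable pi 0 n.
Proof. by move=> i _; rewrite npairing_lt. Qed.

Hypothesis theta_nc : noncrossing theta.

Lemma card_legs d : #|midx N 'I_d| = (N ^ d)%N.
Proof. by rewrite card_ffun !card_ord. Qed.

Lemma ptrace_le (A : 'I_n -> tensmx R N (d1 + d2)) :
  (forall i, opnorm (A i) <= 1) ->
  opnorm (ptrace rho A) <= N%:R ^+ (d1 * (1 + m)).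
Proof.
move=> A1; apply: opnorm_le => [|v]; first by rewrite exprn_ge0.
rewrite l2norm_leP ?exprn_ge0 //.
rewrite (normsq_col _ row_bij) (normsq_col _ col_bij).
have -> : (fun u => (ptrace rho A *m v) (row u) 0) =
    ptrop (transfer (nblock m_gt0 A) pi 0 n) (fun u => v (col u) 0).
  by apply: funext => u; rewrite ptrace_mulmx.
have Ac i x : normsq (kapply (nblock m_gt0 A i) x) <= normsq x.
  exact: normsq_block.
have := normsq_transfer (nc_npairing _ theta_nc) Ac
  (leqnn n : (0 <= n <= n)%N) stable_npairing.
move/normsq_ptrop/le_trans; apply.
(* The final trace adds [2] to the exponent [n], and [2 + n] is twice [1 + m]. *)
rewrite subn0 -exprD card_legs natrX -exprM rmorphXn rmorph_nat -exprM.
by rewrite (_ : d1 * (1 + m) * 2 = d1 * (2 + n))%N //; lia.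
Qed.

(** Once rows and columns are both indexed by [U], the partial trace is a scalar matrix. *)
Lemma ptrace_id : (0 < N)%N ->
  opnorm (ptrace rho (fun=> 1%:M : tensmx R N (d1 + d2))) =
    N%:R ^+ (d1 * (1 + m)).
Proof.
move=> N0; apply: opnorm_eq => [||v]; first by rewrite exprn_ge0.
  by apply/card_gt0P; exists (col_idx theta s0 [ffun=> Ordinal N0]).
apply: l2norm_eq; first by rewrite exprn_ge0.
rewrite (normsq_col _ row_bij) (normsq_col _ col_bij).
rewrite /normsq mulr_sumr; apply: eq_bigr => u _.
have -> : (ptrace rho (fun=> 1%:M) *m v) (row u) 0 =
    N%:R ^+ (d1 * (1 + m)) * v (col u) 0.
  rewrite ptrace_mulmx.
  have -> : nblock m_gt0 (fun=> 1%:M : tensmx R N (d1 + d2)) =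
      fun _ t t' => (t == t')%:R :> R[i].
    apply: funext => i; apply: funext => t; apply: funext => t'.
    by rewrite /nblock /block mxE (inj_eq (bij_inj (tens_rank_bij N d1 d2))).
  have [k ek transfer1] := transfer_id (nc_npairing _ theta_nc) R[i] S U
    (leqnn n : (0 <= n <= n)%N) stable_npairing.
  rewrite /ptrop; under eq_bigr do rewrite transfer1 /= eqxx mul1r.
  (* The pairs give [k = m] loops and the final trace gives one more. *)
  rewrite sumr_const -[LHS]mulr_natl mulrA card_legs -exprS natrX -exprM.
  by rewrite (_ : d1 * k.+1 = d1 * (1 + m))%N //; lia.
rewrite normrM exprMn; congr (_ * _).
by rewrite rmorphXn rmorph_nat normrX normr_nat.
Qed.

End NoncrossingTrace.

Theorem theorem7 (R : realType) (m N d1 d2 : nat) (theta : {perm 'I_m}) :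
  (1 <= m)%N -> (1 <= N)%N -> (1 <= d1)%N -> (1 <= d2)%N ->
  noncrossing theta ->
  (exists2 A : 'I_(2 * m) -> tensmx R N (d1 + d2),
      forall i, opnorm (A i) <= 1
    & opnorm (ptrace (@sigma_tau m d1 d2 theta) A)
        = N%:R ^+ (d1 * (1 + m))) /\
  (forall A : 'I_(2 * m) -> tensmx R N (d1 + d2),
      (forall i, opnorm (A i) <= 1) ->
      opnorm (ptrace (@sigma_tau m d1 d2 theta) A)
        <= N%:R ^+ (d1 * (1 + m))).
Proof.
move=> m_gt0 N_gt0 _ _ nc; pose s0 : midx N 'I_d1 := [ffun=> Ordinal N_gt0].
split; last by move=> A; apply: ptrace_le.
exists (fun=> 1%:M); last exact: ptrace_id.
by move=> i; apply: opnorm_le => // x; rewrite mul1mx mul1r.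
Qed.
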